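(* For all $A,B\in 2^\omega$: $A\oplus B$ is computably random if and only if $A$ is computably random uniformly relative to $B$ and $B$ is computably random uniformly relative to $A$.
   Context: $2^\omega$ is Cantor space; $(A\oplus B)(2n)=A(n)$, $(A\oplus B)(2n+1)=B(n)$. A martingale is a function $d\colon 2^{<\omega}\to[0,\infty)$ with $d(\sigma0)+d(\sigma1)=2d(\sigma)$ for all $\sigma$; it succeeds on $A$ if $\limsup_n d(A\upharpoonright n)=\infty$. A code for a (real-valued) martingale is an element of $\mathbb{N}^\mathbb{N}$ giving, for each $\sigma$, a fast-Cauchy sequence of rationals converging to $d(\sigma)$ (fast-Cauchy: $|q_k-q_m|\le 2^{-m}$ for $k\ge m$); $d$ is computable if it has a computable code. $A$ is computably random if no computable martingale succeeds on it. A uniform martingale test is a total computable map $\Phi\colon 2^\omega\to\mathbb{N}^\mathbb{N}$ such that each $\Phi(X)$ encodes a martingale $d^X$. $A$ is computably random uniformly relative to $B$ if there is no uniform martingale test $\langle d^X\rangle_{X\in 2^\omega}$ such that $d^B$ succeeds on $A$. *)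

(* Defs.v *)
From Stdlib Require Cantor.
From mathcomp Require Import all_boot all_order all_algebra.
From mathcomp Require Import all_classical all_reals all_analysis.

Set Implicit Arguments.
Unset Strict Implicit.
Unset Printing Implicit Defensive.

Import Order.TTheory GRing.Theory Num.Theory.
Import numFieldNormedType.Exports.

Local Open Scope classical_set_scope.
Local Open Scope ring_scope.

Definition cantor : Type := nat -> bool.
Definition baire : Type := nat -> nat.

Definition join (A B : cantor) : cantor :=
  fun n => if odd n then B n./2 else A n./2.

(* Cantor's pairing bijection between nat * nat and nat *)
Definition npair (x y : nat) : nat := Cantor.to_nat (x, y).
Definition nfst (n : nat) : nat := (Cantor.of_nat n).1.
Definition nsnd (n : nat) : nat := (Cantor.of_nat n).2.

(* Kleene's partial recursive functions with an oracle, presented as unary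
   functions: several arguments are passed as one paired argument. *)
Inductive prog : Type :=
| PZero
| PSucc
| PFst
| PSnd
| POracle
| PPair (f g : prog)
| PComp (f g : prog)
| PRec (f g : prog)
| PMu (f : prog).

(* [run X p n v]: with oracle X, the program p halts on input n with output v.
   - PRec f g is primitive recursion: on input <a, 0> it is f a, and on
     <a, k + 1> it is g <a, <k, r>>, r being its value on <a, k>.
   - PMu f is unbounded search: on input n it is the least v such that
     f <n, v> = 0, with f <n, m> defined (and nonzero) for all m < v. *)
Fixpoint run (X : cantor) (p : prog) (n v : nat) {struct p} : Prop :=
  match p with
  | PZero => v = 0%N
  | PSucc => v = n.+1
  | PFst => v = nfst n
  | PSnd => v = nsnd n
  | POracle => v = nat_of_bool (X n)
  | PPair f g => exists a b, [/\ run X f n a, run X g n b & v = npair a b]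
  | PComp f g => exists2 u, run X g n u & run X f u v
  | PRec f g =>
      (fix runrec (k w : nat) {struct k} : Prop :=
         match k with
         | 0 => run X f (nfst n) w
         | k'.+1 => exists2 r, runrec k' r &
                      run X g (npair (nfst n) (npair k' r)) w
         end) (nsnd n) v
  | PMu f => run X f (npair n v) 0 /\
             forall m, (m < v)%N -> exists u, run X f (npair n m) u.+1
  end.

Fixpoint oracle_free (p : prog) : bool :=
  match p with
  | POracle => false
  | PPair f g | PComp f g | PRec f g => oracle_free f && oracle_free g
  | PMu f => oracle_free f
  | _ => true
  end.

(* The quantification over X is immaterial: p never queries it. *)
Definition computable (f : baire) : Prop :=
  exists2 p, oracle_free p & forall X n, run X p n (f n).

Definition computable_map (Phi : cantor -> baire) : Prop :=
  exists p, forall X n, run X p n (Phi X n).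

(* The length-lexicographic bijection between binary strings and nat:
   code (s b) = 2 * code s + 1 + b. *)
Definition str_code (s : seq bool) : nat :=
  foldl (fun (c : nat) (b : bool) => (c.*2 + b).+1) 0%N s.

(* A surjective numbering of the rationals: <<a, b>, c> denotes
   (a - b) / (c + 1). *)
Definition rat_of_code (n : nat) : rat :=
  ((nfst (nfst n))%:R - (nsnd (nfst n))%:R) / (nsnd n).+1%:R.

Definition fast_cauchy (q : nat -> rat) : Prop :=
  forall k m : nat, (m <= k)%N -> `|q k - q m| <= 2^-1 ^+ m.

Definition martingale (R : realType) (d : seq bool -> R) : Prop :=
  (forall s, 0 <= d s) /\
  (forall s, d (rcons s false) + d (rcons s true) = 2 * d s).

Definition code_approx (f : baire) (s : seq bool) : nat -> rat :=
  fun k => rat_of_code (f (npair (str_code s) k)).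

Definition encodes (R : realType) (f : baire) (d : seq bool -> R) : Prop :=
  forall s, fast_cauchy (code_approx f s) /\
            (fun k => ratr (code_approx f s k) : R) @ \oo --> d s.

Definition succeeds (R : realType) (d : seq bool -> R) (A : cantor) : Prop :=
  limn_esup (fun n => (d (mkseq A n))%:E) = +oo%E.

Definition computable_martingale (R : realType) (d : seq bool -> R) : Prop :=
  martingale d /\ exists2 f, computable f & encodes f d.

Definition computably_random (R : realType) (A : cantor) : Prop :=
  ~ exists2 d : seq bool -> R, computable_martingale d & succeeds d A.

Definition uniform_martingale_test (R : realType)
    (Phi : cantor -> baire) (d : cantor -> seq bool -> R) : Prop :=
  computable_map Phi /\ forall X, martingale (d X) /\ encodes (Phi X) (d X).

Definition computably_random_uniformly_rel (R : realType) (A B : cantor) :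
    Prop :=
  ~ exists Phi, exists2 d : cantor -> seq bool -> R,
      uniform_martingale_test Phi d & succeeds (d B) A.

(* Main.v *)
(** Any encoded martingale can be replaced by one with exact rational values and
    values at least 1, uniformly in the code ([rationalize]).

    If such a [D] is unbounded along [A (+) B], write [D] as the product of its
    successive ratios. The ratios at even positions form a martingale that bets
    on [A] with oracle [B], those at odd positions a martingale that bets on [B]
    with oracle [A] ([bets]); both are uniform tests, because [D >= 1] makes the
    division total, and their product is unbounded.

    Conversely let [d^X] be a uniform test with [d^B] unbounded along [A].
    Replace it by a martingale that never falls more than 1 below an earlier
    value ([save]), and average [d^X(sigma)] over all [X] extending [tau]. This
    is a martingale in [sigma (+) tau]; it is computable because a total
    computable map on Cantor space has a computable modulus of continuity
    ([modulus]). Once [d^X(A|n0)] is large for all [X] extending [B|m], the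
    saving property keeps [d^X(A|n)] large for all later [n], hence so is the
    average along [A (+) B]. *)

Require Import Defs.
From Stdlib Require Cantor.
From mathcomp Require Import all_boot all_order all_algebra.
From mathcomp Require Import all_classical all_reals all_analysis.
From mathcomp Require Import zify ring lra.

Set Implicit Arguments.
Unset Strict Implicit.
Unset Printing Implicit Defensive.

Import Order.TTheory GRing.Theory Num.Theory.
Import numFieldNormedType.Exports.

Local Open Scope classical_set_scope.
Local Open Scope nat_scope.

(** * Closure properties of uniformly computable maps *)

Lemma nfst_npair a b : nfst (npair a b) = a.
Proof. by rewrite /nfst /npair Cantor.cancel_of_to. Qed.

Lemma nsnd_npair a b : nsnd (npair a b) = b.
Proof. by rewrite /nsnd /npair Cantor.cancel_of_to. Qed.

Lemma npair_nfst_nsnd n : npair (nfst n) (nsnd n) = n.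
Proof. by rewrite /npair /nfst /nsnd -surjective_pairing Cantor.cancel_to_of. Qed.

Definition npairE := (nfst_npair, nsnd_npair).

(* [cm], [cb], [cs] and [cq] say that a map of the oracle and of a natural
   number is computable, for values in [nat], [bool], [seq bool] and [rat]. *)
Notation cm := computable_map.

(** Every query is answered by 0, so on any oracle the erased program behaves as the original does
    on the all-false one. This turns maps proved computable with an oracle into oracle-free
    programs. *)
Fixpoint erase_oracle (p : prog) : prog :=
  match p with
  | POracle => PZero
  | PPair f g => PPair (erase_oracle f) (erase_oracle g)
  | PComp f g => PComp (erase_oracle f) (erase_oracle g)
  | PRec f g => PRec (erase_oracle f) (erase_oracle g)
  | PMu f => PMu (erase_oracle f)
  | _ => p
  end.

Lemma oracle_free_erase p : oracle_free (erase_oracle p).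
Proof. by elim: p => //= f -> g ->. Qed.

Lemma run_erase X p n v :
  run X (erase_oracle p) n v <-> run (fun=> false) p n v.
Proof.
elim: p n v => //= [f IHf g IHg|f IHf g IHg|f IHf g IHg|f IHf] n v.
- by split=> -[a [b [/IHf ? /IHg ? ?]]]; exists a, b.
- by split=> -[u /IHg ? /IHf ?]; exists u.
- elim: (nsnd n) v => [|k IHk] v /=; first exact: IHf.
  by split=> -[r /IHk ? /IHg ?]; exists r.
- split=> -[/IHf H1 H2]; split=> // m /H2 [u /IHf ?]; by exists u.
Qed.

Lemma computable_at0 F : cm F -> computable (F (fun=> false)).
Proof.
move=> [p Hp]; exists (erase_oracle p) => [|X n]; first exact: oracle_free_erase.
exact/run_erase.
Qed.

Lemma computableP f : computable f <-> cm (fun=> f).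
Proof.
split=> [[p _ Hp]|]; first by exists p.
exact: (@computable_at0 (fun=> f)).
Qed.

Lemma cm_ext F G : (forall X n, F X n = G X n) -> cm G -> cm F.
Proof. by move=> E [p Hp]; exists p => X n; rewrite E. Qed.

Lemma cm_comp F G : cm F -> cm G -> cm (fun X n => F X (G X n)).
Proof.
by move=> [p Hp] [q Hq]; exists (PComp p q) => X n /=; exists (G X n).
Qed.

Lemma cm_npair F G : cm F -> cm G -> cm (fun X n => npair (F X n) (G X n)).
Proof.
move=> [p Hp] [q Hq]; exists (PPair p q) => X n /=.
by exists (F X n), (G X n).
Qed.

Lemma cm_id : cm (fun X n => n).
Proof.
exists (PPair PFst PSnd) => X n /=; exists (nfst n), (nsnd n).
by rewrite npair_nfst_nsnd.
Qed.

Lemma cm_nfst F : cm F -> cm (fun X n => nfst (F X n)).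
Proof. by apply: (@cm_comp (fun X n => nfst n)); exists PFst. Qed.

Lemma cm_nsnd F : cm F -> cm (fun X n => nsnd (F X n)).
Proof. by apply: (@cm_comp (fun X n => nsnd n)); exists PSnd. Qed.

Lemma cm_succ F : cm F -> cm (fun X n => (F X n).+1).
Proof. by apply: (@cm_comp (fun X n => n.+1)); exists PSucc. Qed.

Lemma cm_const k : cm (fun X n => k).
Proof. by elim: k => [|k /cm_succ//]; exists PZero. Qed.

Lemma cm_rec f g k : cm f ->
  cm (fun X n => g X (nfst n) (nfst (nsnd n)) (nsnd (nsnd n))) -> cm k ->
  cm (fun X n => nat_rect (fun=> nat) (f X n) (fun j r => g X n j r) (k X n)).
Proof.
move=> [p Hp] [q Hq] Hk.
(* [PRec] runs on the pair of [n] and the counter, so that base case and step still see the original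
   argument. *)
pose F X n := nat_rect (fun=> nat) (f X (nfst n))
   (fun j r => g X (nfst n) j r) (nsnd n).
apply: (@cm_ext _ (fun X n => F X (npair n (k X n)))) => [X n|].
  by rewrite /F !npairE.
apply: cm_comp (cm_npair cm_id Hk).
exists (PRec p q) => X n; rewrite /F /=.
elim: (nsnd n) => [|j IHj] /=; first exact: Hp.
eexists; first exact: IHj.
by have := Hq X (npair (nfst n) (npair j
    (nat_rect (fun=> nat) (f X (nfst n)) (fun j r => g X (nfst n) j r) j)));
  rewrite !npairE.
Qed.

Lemma cm_search F : cm (fun X n => F X (nfst n) (nsnd n)) ->
  (forall X n, exists v, F X n v = 0) ->
  exists2 G, cm G & forall X n, F X n (G X n) = 0.
Proof.
move=> [p Hp] ex; have ex' X n : exists v, F X n v == 0.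
  by have [v /eqP] := ex X n; exists v.
exists (fun X n => ex_minn (ex' X n)) => [|X n]; last by case: ex_minnP => v /eqP.
exists (PMu p) => X n /=; case: ex_minnP => v /eqP Fv minv.
have E m : run X p (npair n m) (F X n m).
  by have := Hp X (npair n m); rewrite !npairE.
split=> [|m lt_mv]; first by rewrite -Fv.
have := E m; case EF: (F X n m) => [|u]; last by exists u.
by have := minv m; rewrite EF leqNgt lt_mv => /(_ isT).
Qed.

Definition cb (P : cantor -> nat -> bool) := cm (fun X n => nat_of_bool (P X n)).

Lemma cb_ext P Q : (forall X n, P X n = Q X n) -> cb Q -> cb P.
Proof. by move=> E; apply: cm_ext => X n; rewrite E. Qed.

Lemma cm_nat_of_bool P : cb P -> cm (fun X n => nat_of_bool (P X n)).
Proof. by []. Qed.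

Lemma cb_comp P G : cb P -> cm G -> cb (fun X n => P X (G X n)).
Proof. exact: cm_comp. Qed.

Lemma cb_const b : cb (fun X n => b).
Proof. exact: cm_const. Qed.

Lemma cb_oracle F : cm F -> cb (fun X n => X (F X n)).
Proof. by apply: (@cm_comp (fun X n => nat_of_bool (X n))); exists POracle. Qed.

Lemma cm_if P F G : cb P -> cm F -> cm G ->
  cm (fun X n => if P X n then F X n else G X n).
Proof.
move=> HP HF HG.
apply: (@cm_ext _ (fun X n => nat_rect (fun=> nat) (G X n)
   (fun _ _ => F X n) (P X n))) => [X n|]; first by case: (P X n).
apply: cm_rec => //; exact: cm_comp HF (cm_nfst cm_id).
Qed.

Lemma cm_comp2 g a b : cm (fun X n => g X (nfst n) (nsnd n)) ->
  cm a -> cm b -> cm (fun X n => g X (a X n) (b X n)).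
Proof.
move=> Hg Ha Hb; have := cm_comp Hg (cm_npair Ha Hb).
by apply: cm_ext => X n; rewrite !npairE.
Qed.

Lemma cb_comp2 g a b : cb (fun X n => g X (nfst n) (nsnd n)) ->
  cm a -> cm b -> cb (fun X n => g X (a X n) (b X n)).
Proof. exact: (@cm_comp2 (fun X n i => nat_of_bool (g X n i))). Qed.

Create HintDb cm.
#[local] Hint Resolve cm_id cm_const cm_nfst cm_nsnd cm_npair cm_succ
  cm_nat_of_bool cb_const cb_oracle cm_if cm_rec : cm.
#[local] Hint Extern 5 (computable_map _) =>
  match goal with
  | H : computable_map ?F |- _ => apply: (cm_comp H)
  | H : computable_map (fun X n => ?g X (nfst n) (nsnd n)) |- _ =>
      apply: (cm_comp2 H)
  end : cm.
#[local] Hint Extern 5 (cb _) =>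
  match goal with
  | H : cb ?F |- _ => apply: (cb_comp H)
  | H : cb (fun X n => ?g X (nfst n) (nsnd n)) |- _ => apply: (cb_comp2 H)
  end : cm.

Lemma cm_pred F : cm F -> cm (fun X n => (F X n).-1).
Proof.
move=> HF; apply: (@cm_ext _ (fun X n => nat_rect (fun=> nat) 0
  (fun j _ => j) (F X n))) => [X n|]; first by case: (F X n).
by auto 30 with cm.
Qed.

Lemma cm_add F G : cm F -> cm G -> cm (fun X n => F X n + G X n).
Proof.
move=> HF HG; apply: (@cm_ext _ (fun X n => nat_rect (fun=> nat) (F X n)
  (fun _ r => r.+1) (G X n))) => [X n|]; last by auto 30 with cm.
by elim: (G X n) => [|k IH] /=; rewrite ?addn0 // addnS IH.
Qed.
#[local] Hint Resolve cm_pred cm_add : cm.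

Lemma cm_sub F G : cm F -> cm G -> cm (fun X n => F X n - G X n).
Proof.
move=> HF HG; apply: (@cm_ext _ (fun X n => nat_rect (fun=> nat) (F X n)
  (fun _ r => r.-1) (G X n))) => [X n|]; last by auto 30 with cm.
by elim: (G X n) => [|k IH] /=; rewrite ?subn0 // subnS IH.
Qed.

Lemma cm_sum N F : cm N -> cm (fun X n => F X (nfst n) (nsnd n)) ->
  cm (fun X n => \sum_(0 <= i < N X n) F X n i).
Proof.
move=> HN HF; apply: (@cm_ext _ (fun X n => nat_rect (fun=> nat) 0
  (fun i r => r + F X n i) (N X n))) => [X n|]; last by auto 30 with cm.
by elim: (N X n) => [|k IH]; [rewrite big_geq | rewrite big_nat_recr //= IH].
Qed.
#[local] Hint Resolve cm_sub cm_sum : cm.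

Lemma cm_mul F G : cm F -> cm G -> cm (fun X n => F X n * G X n).
Proof.
move=> HF HG; apply: (@cm_ext _ (fun X n => \sum_(0 <= i < G X n) F X n)).
  by move=> X n; rewrite sum_nat_const_nat subn0 mulnC.
by auto 30 with cm.
Qed.
#[local] Hint Resolve cm_mul : cm.

Lemma cm_expn F G : cm F -> cm G -> cm (fun X n => F X n ^ G X n).
Proof.
move=> HF HG; apply: (@cm_ext _ (fun X n => nat_rect (fun=> nat) 1
  (fun _ r => F X n * r) (G X n))) => [X n|]; last by auto 30 with cm.
by elim: (G X n) => [|k IH] //=; rewrite expnS IH.
Qed.

Lemma cm_double F : cm F -> cm (fun X n => (F X n).*2).
Proof.
move=> HF; apply: (@cm_ext _ (fun X n => F X n + F X n)); last by auto 30 with cm.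
by move=> X n; rewrite addnn.
Qed.

Lemma cb_not P : cb P -> cb (fun X n => ~~ P X n).
Proof.
move=> HP; apply: (@cm_ext _ (fun X n => 1 - P X n)) => [X n|].
  by case: (P X n).
by auto 30 with cm.
Qed.

Lemma cb_and P Q : cb P -> cb Q -> cb (fun X n => P X n && Q X n).
Proof.
move=> HP HQ; apply: (@cm_ext _ (fun X n => P X n * Q X n)) => [X n|].
  by rewrite mulnb.
by auto 30 with cm.
Qed.

Lemma cb_eq0 F : cm F -> cb (fun X n => F X n == 0).
Proof.
move=> HF; apply: (@cm_ext _ (fun X n => 1 - F X n)) => [X n|].
  by case: (F X n).
by auto 30 with cm.
Qed.
#[local] Hint Resolve cm_expn cm_double cb_not cb_and cb_eq0 : cm.

Lemma cb_leq F G : cm F -> cm G -> cb (fun X n => F X n <= G X n).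
Proof. by move=> HF HG; apply: cb_eq0; auto 30 with cm. Qed.

Lemma cb_ltn F G : cm F -> cm G -> cb (fun X n => F X n < G X n).
Proof. by move=> HF HG; apply: cb_leq; auto 30 with cm. Qed.
#[local] Hint Resolve cb_leq cb_ltn : cm.

Lemma cb_eqn F G : cm F -> cm G -> cb (fun X n => F X n == G X n).
Proof.
move=> HF HG; apply: (@cb_ext _ (fun X n => (F X n <= G X n) && (G X n <= F X n))).
  by move=> X n; rewrite eqn_leq.
by auto 30 with cm.
Qed.

Lemma cb_eqb P Q : cb P -> cb Q -> cb (fun X n => P X n == Q X n).
Proof.
move=> HP HQ.
apply: (@cb_ext _ (fun X n => nat_of_bool (P X n) == nat_of_bool (Q X n))).
  by move=> X n; case: (P X n); case: (Q X n).
exact: cb_eqn.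
Qed.

Lemma cb_if P F G : cb P -> cb F -> cb G ->
  cb (fun X n => if P X n then F X n else G X n).
Proof.
move=> HP HF HG; apply: (cm_ext _ (cm_if HP HF HG)) => X n.
by case: (P X n).
Qed.
#[local] Hint Resolve cb_eqn cb_eqb cb_if : cm.

Lemma cb_odd F : cm F -> cb (fun X n => odd (F X n)).
Proof.
move=> HF; apply: (@cm_ext _ (fun X n => nat_rect (fun=> nat) 0
  (fun _ r => 1 - r) (F X n))) => [X n|]; last by auto 30 with cm.
by elim: (F X n) => [|k IH] //=; rewrite -IH; case: (odd k).
Qed.
#[local] Hint Resolve cb_odd : cm.

Lemma cm_half F : cm F -> cm (fun X n => (F X n)./2).
Proof.
move=> HF; apply: (@cm_ext _ (fun X n => nat_rect (fun=> nat) 0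
  (fun j r => r + odd j) (F X n))) => [X n|]; last by auto 30 with cm.
elim: (F X n) => [|k IH] //; rewrite [nat_rect _ _ _ _]/= -IH; lia.
Qed.
#[local] Hint Resolve cm_half : cm.

Lemma cm_iter f K F :
  cm (fun X n => f X (nfst n) (nsnd n)) -> cm K -> cm F ->
  cm (fun X n => iter (K X n) (f X n) (F X n)).
Proof.
move=> Hf HK HF; apply: (@cm_ext _ (fun X n => nat_rect (fun=> nat) (F X n)
  (fun _ r => f X n r) (K X n))) => [X n|]; last by auto 30 with cm.
by elim: (K X n) => [|k IH] //=; rewrite IH.
Qed.
#[local] Hint Resolve cm_iter : cm.

(** * Computability on binary strings *)

Lemma str_code_rcons s b : str_code (rcons s b) = ((str_code s).*2 + b).+1.
Proof. by rewrite /str_code foldl_rcons. Qed.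

Lemma str_code_inj : injective str_code.
Proof.
elim/last_ind=> [|s a IHs]; elim/last_ind=> [|t b _] //;
  rewrite ?str_code_rcons // => -[] E.
by have [/IHs-> ->] : str_code s = str_code t /\ a = b by case: a E; case: b; lia.
Qed.

Lemma str_code_surj n : exists s, str_code s = n.
Proof.
elim/ltn_ind: n => -[|n] IHn; first by exists [::].
have /IHn[s Es] : n./2 < n.+1 by lia.
by exists (rcons s (odd n)); rewrite str_code_rcons Es; lia.
Qed.

(** The inverse is picked by choice; this does not harm computability, since [cs] looks only at
    codes, on which [str_of] is the identity. *)
Definition str_of (n : nat) : seq bool := xget [::] [set s | str_code s = n].

Lemma str_ofK n : str_code (str_of n) = n.
Proof.
rewrite /str_of; case: xgetP => [s _ //|].
by have [s /[swap]/(_ s)] := str_code_surj n.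
Qed.

Lemma str_codeK s : str_of (str_code s) = s.
Proof. by apply: str_code_inj; rewrite str_ofK. Qed.

Definition cs (S : cantor -> nat -> seq bool) := cm (fun X n => str_code (S X n)).

Lemma cs_comp S G : cs S -> cm G -> cs (fun X n => S X (G X n)).
Proof. exact: cm_comp. Qed.

Lemma cm_str_code S : cs S -> cm (fun X n => str_code (S X n)).
Proof. by []. Qed.

Lemma cs_str_of F : cm F -> cs (fun X n => str_of (F X n)).
Proof. by apply: cm_ext => X n; rewrite str_ofK. Qed.

Lemma cs_const s : cs (fun X n => s).
Proof. exact: cm_const. Qed.
#[local] Hint Resolve cm_str_code cs_str_of cs_const : cm.
#[local] Hint Extern 5 (cs _) =>
  match goal with H : cs ?F |- _ => apply: (cs_comp H) end : cm.

Lemma cs_rcons S P : cs S -> cb P -> cs (fun X n => rcons (S X n) (P X n)).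
Proof.
move=> HS HP; apply: (@cm_ext _ (fun X n => ((str_code (S X n)).*2 + P X n).+1)).
  by move=> X n; rewrite str_code_rcons.
by auto 30 with cm.
Qed.

(** Dropping the last letter sends the code [c] to [c.-1./2]; the code 0 of the empty string is a
    fixed point, in agreement with the truncated subtraction. *)
Lemma str_code_belast s k :
  iter k (fun c => c.-1./2) (str_code s) = str_code (take (size s - k) s).
Proof.
elim: k => [|k IHk] /=; first by rewrite subn0 take_size.
rewrite {}IHk; case: (ltnP k (size s)) => [ltk|lek]; last first.
  by move: (leqW lek); rewrite -!subn_eq0 => /eqP-> /=; move: lek;
    rewrite -subn_eq0 => /eqP->; rewrite take0.
rewrite -[in LHS](subnSK ltk) (take_nth false) ?str_code_rcons; last first.
  by rewrite ltn_subrL (leq_ltn_trans _ ltk).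
by rewrite /= halfD odd_double doubleK add0n; case: nth; rewrite addn0.
Qed.

Lemma size_le_str_code s : size s <= str_code s.
Proof.
elim/last_ind: s => // s b IH; rewrite size_rcons str_code_rcons; lia.
Qed.

Lemma str_code_eq0 s : (str_code s == 0) = (size s == 0).
Proof. by elim/last_ind: s => // s b _; rewrite str_code_rcons size_rcons. Qed.

Lemma cm_size S : cs S -> cm (fun X n => size (S X n)).
Proof.
(* The length counts the [k] for which removing [k] last letters leaves a nonempty string; the code
   bounds the length, hence the range of [k]. *)
move=> HS; apply: (@cm_ext _ (fun X n => \sum_(0 <= k < str_code (S X n))
  (iter k (fun c => c.-1./2) (str_code (S X n)) != 0))) => [X n|].
  set s := S X n; under eq_bigr => k _ do rewrite str_code_belast str_code_eq0.
  rewrite (big_cat_nat _ (n := size s)) ?size_le_str_code //=.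
  rewrite [X in _ + X]big_nat_cond [X in _ + X]big1 ?addn0; last first.
    by move=> k /andP[/andP[lek _] _]; rewrite size_take; case: ltnP; lia.
  rewrite big_nat_cond (eq_bigr (fun=> 1)); last first.
    by move=> k /andP[/andP[_ ltk] _]; rewrite size_take; case: ltnP; lia.
  by rewrite -big_nat_cond sum_nat_const_nat subn0 muln1.
by auto 30 with cm.
Qed.
#[local] Hint Resolve cs_rcons cm_size : cm.

Lemma cs_take K S : cm K -> cs S -> cs (fun X n => take (K X n) (S X n)).
Proof.
move=> HK HS; apply: (@cm_ext _ (fun X n =>
  iter (size (S X n) - K X n) (fun c => c.-1./2) (str_code (S X n)))).
  move=> X n; rewrite str_code_belast; congr str_code.
  case: (leqP (K X n) (size (S X n))) => [le|lt]; first by rewrite subKn.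
  by rewrite !take_oversize //; lia.
by auto 30 with cm.
Qed.
#[local] Hint Resolve cs_take : cm.

Lemma cb_nth S K : cs S -> cm K -> cb (fun X n => nth false (S X n) (K X n)).
Proof.
(* The wanted letter ends the prefix of length [K + 1], and a nonempty string ends in 1 exactly when
   its code is even. The guard gives the default past the end. *)
move=> HS HK; apply: (@cb_ext _ (fun X n => (K X n < size (S X n)) &&
   ~~ odd (str_code (take (K X n).+1 (S X n))))) => [X n|]; last by auto 30 with cm.
case: ltnP => [lt|ge]; last by rewrite nth_default.
rewrite (take_nth false) // str_code_rcons /= negbK oddD odd_double /=.
by case: nth.
Qed.

Lemma cs_mkseq P K : cb (fun X n => P X (nfst n) (nsnd n)) -> cm K ->
  cs (fun X n => mkseq (P X n) (K X n)).
Proof.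
move=> HP HK; apply: (@cm_ext _ (fun X n => nat_rect (fun=> nat) 0
  (fun j r => (r.*2 + P X n j).+1) (K X n))) => [X n|].
  by elim: (K X n) => [|k IH] //=; rewrite -IH mkseqS str_code_rcons.
by auto 30 with cm.
Qed.
#[local] Hint Resolve cb_nth cs_mkseq : cm.

(** * Computable rational-valued maps *)

Local Open Scope ring_scope.

Definition cq (F : cantor -> nat -> rat) :=
  exists2 G, cm G & forall X n, F X n = rat_of_code (G X n).

Lemma cq_ext F G : (forall X n, F X n = G X n) -> cq G -> cq F.
Proof. by move=> E [H HH EH]; exists H => // X n; rewrite E. Qed.

Lemma cq_rat_of_code F : cm F -> cq (fun X n => rat_of_code (F X n)).
Proof. by move=> HF; exists F. Qed.

Lemma cq_comp F G : cq F -> cm G -> cq (fun X n => F X (G X n)).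
Proof. by move=> [H HH E] HG; exists (fun X n => H X (G X n)); auto 30 with cm. Qed.

Lemma cq_comp2 g a b : cq (fun X n => g X (nfst n) (nsnd n)) ->
  cm a -> cm b -> cq (fun X n => g X (a X n) (b X n)).
Proof.
move=> Hg Ha Hb; have := cq_comp Hg (cm_npair Ha Hb).
by apply: cq_ext => X n; rewrite !npairE.
Qed.

Lemma rat_of_codeE a b c :
  rat_of_code (npair (npair a b) c) = (a%:R - b%:R) / c.+1%:R.
Proof. by rewrite /rat_of_code !npairE. Qed.

Lemma cq_frac A B C : cm A -> cm B -> cm C ->
  cq (fun X n => ((A X n)%:R - (B X n)%:R) / (C X n).+1%:R).
Proof.
move=> HA HB HC; exists (fun X n => npair (npair (A X n) (B X n)) (C X n)).
  by auto 30 with cm.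
by move=> X n; rewrite rat_of_codeE.
Qed.

Lemma cq_nat F : cm F -> cq (fun X n => (F X n)%:R).
Proof.
move=> HF; have := cq_frac HF (cm_const 0) (cm_const 0).
by apply: cq_ext => X n; rewrite subr0 divr1.
Qed.

Lemma cq_const k : cq (fun X n => k%:R).
Proof. exact: cq_nat (cm_const k). Qed.

Lemma cq_one : cq (fun X n => 1).
Proof. exact: (cq_const 1). Qed.

Lemma cqP F : cq F -> exists A B C, [/\ cm A, cm B, cm C &
  forall X n, F X n = ((A X n)%:R - (B X n)%:R) / (C X n).+1%:R].
Proof.
move=> [G HG E]; exists (fun X n => nfst (nfst (G X n))),
  (fun X n => nsnd (nfst (G X n))), (fun X n => nsnd (G X n)).
by split; auto 30 with cm.
Qed.

Lemma cq_add F G : cq F -> cq G -> cq (fun X n => F X n + G X n).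
Proof.
move=> /cqP[a [b [c [Ha Hb Hc EF]]]] /cqP[a' [b' [c' [Ha' Hb' Hc' EG]]]].
(* A code stores the predecessor of the denominator, hence [.-1.+1] around the positive product. *)
apply: (@cq_ext _ (fun X n =>
  ((a X n * (c' X n).+1 + a' X n * (c X n).+1)%:R -
   (b X n * (c' X n).+1 + b' X n * (c X n).+1)%:R) /
  ((c X n).+1 * (c' X n).+1).-1.+1%:R)) => [X n|].
  rewrite EF EG prednK ?muln_gt0 // !natrD !natrM.
  have x0 : (c X n).+1%:R != 0 :> rat by rewrite pnatr_eq0.
  have y0 : (c' X n).+1%:R != 0 :> rat by rewrite pnatr_eq0.
  move: (c X n).+1%:R (c' X n).+1%:R x0 y0 => x y x0 y0.
  by field; apply/andP.
by apply: cq_frac; auto 30 with cm.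
Qed.

Lemma cq_opp F : cq F -> cq (fun X n => - F X n).
Proof.
move=> /cqP[a [b [c [Ha Hb Hc EF]]]].
apply: (cq_ext _ (cq_frac Hb Ha Hc)) => X n.
by rewrite EF -mulNr opprB.
Qed.

Lemma cq_mul F G : cq F -> cq G -> cq (fun X n => F X n * G X n).
Proof.
move=> /cqP[a [b [c [Ha Hb Hc EF]]]] /cqP[a' [b' [c' [Ha' Hb' Hc' EG]]]].
apply: (@cq_ext _ (fun X n =>
  ((a X n * a' X n + b X n * b' X n)%:R -
   (a X n * b' X n + b X n * a' X n)%:R) /
  ((c X n).+1 * (c' X n).+1).-1.+1%:R)) => [X n|].
  rewrite EF EG prednK ?muln_gt0 // !natrD !natrM invfM.
  by ring.
by apply: cq_frac; auto 30 with cm.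
Qed.

Lemma cq_if P F G : cb P -> cq F -> cq G ->
  cq (fun X n => if P X n then F X n else G X n).
Proof.
move=> HP [f Hf EF] [g Hg EG].
exists (fun X n => if P X n then f X n else g X n) => [|X n]; first exact: cm_if.
by rewrite EF EG; case: ifP.
Qed.

Lemma cb_ge0 F : cq F -> cb (fun X n => 0 <= F X n).
Proof.
move=> /cqP[a [b [c [Ha Hb Hc EF]]]].
apply: (cb_ext _ (cb_leq Hb Ha)) => X n.
by rewrite EF pmulr_lge0 ?invr_gt0 ?ltr0n // subr_ge0 ler_nat.
Qed.

Lemma cb_le F G : cq F -> cq G -> cb (fun X n => F X n <= G X n).
Proof.
move=> HF HG; apply: (cb_ext _ (cb_ge0 (cq_add HG (cq_opp HF)))) => X n.
by rewrite subr_ge0.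
Qed.

Lemma cq_max F G : cq F -> cq G -> cq (fun X n => Num.max (F X n) (G X n)).
Proof.
move=> HF HG; apply: (cq_ext _ (cq_if (cb_le HF HG) HG HF)) => X n.
by rewrite maxEle.
Qed.

Lemma cq_inv F : cq F -> cq (fun X n => (F X n)^-1).
Proof.
move=> /cqP[a [b [c [Ha Hb Hc EF]]]].
apply: (@cq_ext _ (fun X n =>
  if (a X n == b X n)%N then 0%:R else
  if (b X n <= a X n)%N then (((c X n).+1)%:R - 0%:R) / ((a X n - b X n).-1)%N.+1%:R
  else (0%:R - ((c X n).+1)%:R) / ((b X n - a X n).-1)%N.+1%:R)) => [X n|].
  rewrite EF; case: eqVneq => [->|neq]; first by rewrite subrr mul0r invr0.
  rewrite invfM invrK mulrC; case: leqP => [le|lt].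
    by rewrite prednK ?natrB ?subr0 // subn_gt0 ltn_neqAle eq_sym neq.
  by rewrite prednK ?subn_gt0 // natrB 1?ltnW // sub0r -opprB invrN mulrN mulNr.
apply: cq_if; first by auto 30 with cm.
  exact: cq_const.
by apply: cq_if; [|apply: cq_frac..]; auto 30 with cm.
Qed.
#[local] Hint Resolve cq_rat_of_code cq_nat cq_const cq_one cq_add cq_opp cq_mul cq_inv
  cq_if cq_max cb_le : cm.
#[local] Hint Extern 5 (cq _) =>
  match goal with
  | H : cq ?F |- _ => apply: (cq_comp H)
  | H : cq (fun X n => ?g X (nfst n) (nsnd n)) |- _ => apply: (cq_comp2 H)
  end : cm.

(** The recursion runs on codes: the closure hypothesis, applied to the two decoded components of a
    pair, gives a single operation [h] on codes. *)
Lemma cq_rec (op : rat -> rat -> rat) f g k :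
  (forall F G, cq F -> cq G -> cq (fun X n => op (F X n) (G X n))) ->
  cq f -> cq (fun X n => g X (nfst n) (nsnd n)) -> cm k ->
  cq (fun X n => nat_rect (fun=> rat) (f X n) (fun j r => op r (g X n j)) (k X n)).
Proof.
move=> Hop [F HF EF] [G HG EG] Hk.
have [h Hh Eh] := Hop _ _ (cq_rat_of_code (cm_nfst cm_id))
                          (cq_rat_of_code (cm_nsnd cm_id)).
exists (fun X n => nat_rect (fun=> nat) (F X n)
   (fun j r => h X (npair r (G X (npair n j)))) (k X n)) => [|X n].
  by auto 30 with cm.
elim: (k X n) => [|j /= ->] //=.
by rewrite -Eh !npairE -EG !npairE.
Qed.

Lemma cq_sum N F : cm N -> cq (fun X n => F X (nfst n) (nsnd n)) ->
  cq (fun X n => \sum_(0 <= i < N X n) F X n i).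
Proof.
move=> HN HF; apply: (cq_ext _ (cq_rec cq_add (cq_const 0) HF HN)) => X n.
by elim: (N X n) => [|j IH]; [rewrite big_geq | rewrite big_nat_recr //= IH].
Qed.

Lemma cq_prod N F : cm N -> cq (fun X n => F X (nfst n) (nsnd n)) ->
  cq (fun X n => \prod_(0 <= i < N X n) F X n i).
Proof.
move=> HN HF; apply: (cq_ext _ (cq_rec cq_mul (cq_const 1) HF HN)) => X n.
by elim: (N X n) => [|j IH]; [rewrite big_geq | rewrite big_nat_recr //= IH].
Qed.
#[local] Hint Resolve cq_sum cq_prod : cm.

(** * Bounded evaluation and moduli of continuity *)

Local Open Scope nat_scope.

(* Least [v < m] with [F v = 1], provided that [F j > 1] for all [j < v]; the
   value is shifted by one and is 0 when there is no such [v].  In the scan, 0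
   means that the search goes on and 1 that it has failed. *)
Definition scan (F : nat -> nat) (m : nat) : nat :=
  nat_rect (fun=> nat) 0 (fun j t =>
    if t == 0 then (if F j == 0 then 1 else if F j == 1 then j.+2 else 0)
    else t) m.

Lemma scan_eq0 F m : scan F m = 0 <-> forall j, j < m -> 1 < F j.
Proof.
elim: m => [|m IHm] //=; case: eqP => [/IHm H|H]; last first.
  by split=> // H'; case: H; apply/IHm => j ltj; apply: H'; lia.
split=> [E j|H'].
  rewrite ltnS leq_eqVlt => /orP[/eqP->|/H//].
  by move: E; case: (F m) => [|[]].
by have := H' m (ltnSn m); case: (F m) => [|[]].
Qed.

Lemma scanP F m v : scan F m = v.+2 <->
  [/\ v < m, F v = 1 & forall j, j < v -> 1 < F j].
Proof.
elim: m => [|m IHm]; first by split=> // -[].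
rewrite [scan F m.+1]/=; case: eqP => [/scan_eq0 H|H].
  split=> [|[ltv Fv Hv]].
    case: eqP => // nF0; case: eqP => // F1 -[<-]; split=> //.
  have /eqP E : v == m.
    by rewrite eqn_leq -ltnS ltv leqNgt; apply/negP => /H; rewrite Fv.
  by rewrite -E Fv.
split=> [/IHm[]|[ltv Fv Hv]]; first by split=> //; apply: ltnW.
apply/IHm; split=> //; rewrite ltn_neqAle -ltnS ltv andbT.
by apply/eqP => E; case: H; apply/scan_eq0; rewrite -E.
Qed.

(** The predecessor merges the running and the failed state of a scan into 0, the mark for a missing
    value in [ev]. *)
Lemma scan_predP F m v : (scan F m).-1 = v.+1 <-> scan F m = v.+2.
Proof. by case: scan => [|[]] //= n; split=> -[->]. Qed.

(* Evaluation of [p] with oracle [X] in which only queries below [m] are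
   answered and unbounded searches stop at [m]; the value is shifted by one and
   0 means that no value has been found. *)
Fixpoint ev (p : prog) (X : cantor) (m n : nat) {struct p} : nat :=
  match p with
  | PZero => 1
  | PSucc => n.+2
  | PFst => (nfst n).+1
  | PSnd => (nsnd n).+1
  | POracle => if n < m then (X n).+1 else 0
  | PPair f g => if (ev f X m n == 0) || (ev g X m n == 0) then 0
                 else (npair (ev f X m n).-1 (ev g X m n).-1).+1
  | PComp f g => if ev g X m n == 0 then 0 else ev f X m (ev g X m n).-1
  | PRec f g => nat_rect (fun=> nat) (ev f X m (nfst n)) (fun k r =>
      if r == 0 then 0 else ev g X m (npair (nfst n) (npair k r.-1))) (nsnd n)
  | PMu f => (scan (fun v => ev f X m (npair n v)) m).-1
  end.

Lemma ev_local p X Y m n : (forall i, i < m -> X i = Y i) ->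
  ev p X m n = ev p Y m n.
Proof.
move=> E; elim: p n => //= [n|f IHf g IHg n|f IHf g IHg n|f IHf g IHg n|f IHf n].
- by case: ltnP => // /E->.
- by rewrite IHf IHg.
- by rewrite IHg IHf.
- by elim: (nsnd n) => [|k IHk] //=; rewrite IHk IHg.
- by congr (scan _ _).-1; apply/funext => v; rewrite IHf.
Qed.

Lemma ev_mono p X m m' n v : m <= m' -> ev p X m n = v.+1 -> ev p X m' n = v.+1.
Proof.
move=> le_mm'.
elim: p n v => //= [n v|f IHf g IHg n v|f IHf g IHg n v|f IHf g IHg n v|f IHf n v].
- by case: ltnP => // lt_nm; rewrite (leq_trans lt_nm le_mm').
- case Ef: (ev f X m n) => [|a] //; case Eg: (ev g X m n) => [|b] //=.
  by rewrite (IHf _ _ Ef) (IHg _ _ Eg).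
- by case Eg: (ev g X m n) => [|b] //=; rewrite (IHg _ _ Eg) /=; apply: IHf.
- elim: (nsnd n) v => [|k IHk] v /=; first exact: IHf.
  by case E: (nat_rect _ _ _ _) => [|r] //=; rewrite (IHk _ E) /=; apply: IHg.
- move=> /scan_predP/scanP[ltv Ev Hj]; apply/scan_predP/scanP; split.
  + exact: leq_trans le_mm'.
  + exact: IHf.
  + move=> j /Hj; case E: ev => [|[|u]] // _.
    by rewrite (IHf _ _ E).
Qed.

(** A halting run makes finitely many queries and trials; monotonicity of [ev] allows the bounds of
    subcomputations to be replaced by their maximum. *)
Lemma ev_complete p X n v : run X p n v -> exists m, ev p X m n = v.+1.
Proof.
elim: p n v => //= [n v|n v|n v|n v|n v|f IHf g IHg n v|f IHf g IHg n v
                   |f IHf g IHg n v|f IHf n v].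
- by move=> ->; exists 0.
- by move=> ->; exists 0.
- by move=> ->; exists 0.
- by move=> ->; exists 0.
- by move=> ->; exists n.+1; rewrite ltnSn.
- move=> [a [b [/IHf[m1 E1] /IHg[m2 E2] ->]]]; exists (maxn m1 m2).
  by rewrite (ev_mono (leq_maxl _ _) E1) (ev_mono (leq_maxr _ _) E2).
- move=> [u /IHg[m1 E1] /IHf[m2 E2]]; exists (maxn m1 m2).
  by rewrite (ev_mono (leq_maxl _ _) E1) (ev_mono (leq_maxr _ _) E2).
- elim: (nsnd n) v => [|k IHk] v /=; first exact: IHf.
  move=> [r /IHk[m1 E1] /IHg[m2 E2]]; exists (maxn m1 m2).
  suff -> : nat_rect (fun=> nat) (ev f X (maxn m1 m2) (nfst n)) (fun k r =>
      if r == 0 then 0 else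
      ev g X (maxn m1 m2) (npair (nfst n) (npair k r.-1))) k = r.+1.
    by rewrite (ev_mono (leq_maxr _ _) E2).
  (* Monotonicity for the whole program [PRec f g] at counter [k] raises the bound inside the
     partial recursion. *)
  have := @ev_mono (PRec f g) X m1 (maxn m1 m2) (npair (nfst n) k) r.
  by rewrite /= !npairE => -> //; apply: leq_maxl.
- move=> [/IHf[m0 E0] Hj].
  have [m Hm] : exists m, forall j, j < v -> 1 < ev f X m (npair n j).
    elim: v {E0} Hj => [|v IHv] Hj; first by exists 0.
    have [|m Hm] := IHv; first by move=> j ltj; apply: Hj; apply: ltnW.
    have [u /IHf[m' E']] := Hj v (ltnSn v).
    exists (maxn m m') => j; rewrite ltnS leq_eqVlt => /orP[/eqP->|/Hm].
      by rewrite (ev_mono (leq_maxr _ _) E').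
    case E: ev => [|[|w]] // _.
    by rewrite (ev_mono (leq_maxl _ _) E).
  exists (maxn v.+1 (maxn m0 m)); apply/scan_predP/scanP; split.
  + exact: leq_maxl.
  + by apply: ev_mono E0; lia.
  + move=> j /Hm; case E: ev => [|[|w]] // _.
    by rewrite (ev_mono _ E) //; lia.
Qed.

(** Induction on the fixed program: with bounded searches every clause of [ev] is a closure
    operation. The oracle may vary with the input, so that one computation can try many oracles in
    turn. *)
Lemma cm_ev p (Y : cantor -> nat -> cantor) a m x :
  cb (fun X n => Y X (nfst n) (nsnd n)) -> cm a -> cm m -> cm x ->
  cm (fun X n => ev p (Y X (a X n)) (m X n) (x X n)).
Proof.
move=> HY; elim: p a m x =>
  [|||||f IHf g IHg|f IHf g IHg|f IHf g IHg|f IHf] a m x Ha Hm Hx /=;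
  rewrite /scan; auto 30 with cm.
apply: (@cm_ext _ (fun X n => if ev f (Y X (a X n)) (m X n) (x X n) == 0 then 0
   else if ev g (Y X (a X n)) (m X n) (x X n) == 0 then 0 else
   (npair (ev f (Y X (a X n)) (m X n) (x X n)).-1
          (ev g (Y X (a X n)) (m X n) (x X n)).-1).+1)).
  by move=> X n; case: eqP.
by auto 30 with cm.
Qed.

(** Konig's lemma. A string is bad if no single bound works for all its extensions; were the empty
    string bad, there would be a path [Z] of bad strings, against the bound that works for [Z] and
    depends on finitely many of its bits. *)
Lemma cantor_compact (Q : cantor -> nat -> Prop) :
  (forall X Y m, (forall i, i < m -> X i = Y i) -> Q X m -> Q Y m) ->
  (forall X m m', m <= m' -> Q X m -> Q X m') ->
  (forall X, exists m, Q X m) -> exists m, forall X, Q X m.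
Proof.
move=> Qloc Qmono Qtot; apply: contrapT => nQ.
pose bad s := forall m, exists2 X, ~ Q X m & mkseq X (size s) = s.
have bad0 : bad [::].
  move=> m; apply: contrapT => H; apply: nQ; exists m => X.
  by apply: contrapT => nX; apply: H; exists X.
have badS s : bad s -> exists b, bad (rcons s b).
  move=> Hs; apply: contrapT => /forallNP H.
  (* If neither child is bad, the larger of their two bounds works for [s]. *)
  have [/existsNP[m0 H0] /existsNP[m1 H1]] := (H false, H true).
  have [X nX Xs] := Hs (maxn m0 m1).
  have E : mkseq X (size s).+1 = rcons s (X (size s)) by rewrite mkseqS Xs.
  case EX: (X (size s)) E => E; [apply: H1|apply: H0]; exists X;
    rewrite ?size_rcons // => QX; apply: nX; apply: Qmono QX; lia.
pose nxt s := xget false [set b | bad (rcons s b)].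
pose pth := fix pth n := if n is k.+1 then rcons (pth k) (nxt (pth k)) else [::].
have bad_pth n : bad (pth n).
  elim: n => [|n IHn] //=; have [b Hb] := badS _ IHn.
  by rewrite /nxt; case: xgetP => [c _ //|/(_ b)].
pose Z n := nxt (pth n).
have pthE n : pth n = mkseq Z n by elim: n => [|n IHn] //=; rewrite mkseqS IHn /Z IHn.
have [m Qm] := Qtot Z; have [X nX] := bad_pth m m.
rewrite pthE size_mkseq => E; apply: nX; apply: Qloc Qm => i ltim.
by have /(congr1 (nth false ^~ i)) := E; rewrite !nth_mkseq.
Qed.

(** Past [s] come the binary digits of [c], least significant first, so [c < 2 ^ k] enumerates all
    continuations of [s] by [k] bits, each followed by zeros. *)
Definition extend (s : seq bool) (c i : nat) : bool :=
  if i < size s then nth false s i else odd (iter (i - size s) half c).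

Lemma extend_prefix X m : exists2 c, c < 2 ^ m &
  forall i, i < m -> extend [::] c i = X i.
Proof.
elim: m X => [|m IHm] X; first by exists 0.
have [c ltc Hc] := IHm (fun i => X i.+1).
exists (c.*2 + X 0); first by rewrite expnS; case: (X 0); lia.
move=> [_|i]; first by rewrite /extend /= oddD odd_double; case: (X 0).
rewrite ltnS => /Hc; rewrite /extend !subn0 iterSr.
by rewrite (_ : half (c.*2 + X 0) = c) //; case: (X 0); lia.
Qed.

Lemma cb_extend S C I : cs S -> cm C -> cm I ->
  cb (fun X n => extend (S X n) (C X n) (I X n)).
Proof. by move=> HS HC HI; apply: cb_if; auto 30 with cm. Qed.
#[local] Hint Resolve cb_extend : cm.

Lemma cm_ev_extend p S C m x : cs S -> cm C -> cm m -> cm x ->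
  cm (fun X n => ev p (extend (S X n) (C X n)) (m X n) (x X n)).
Proof.
move=> HS HC Hm Hx.
pose Y (X : cantor) a : cantor := extend (str_of (nfst a)) (nsnd a).
apply: (@cm_ext _ (fun X n =>
  ev p (Y X (npair (str_code (S X n)) (C X n))) (m X n) (x X n))) => [X n|].
  by rewrite /Y !npairE str_codeK.
by apply: cm_ev => //; rewrite /Y; auto 30 with cm.
Qed.
#[local] Hint Resolve cm_ev_extend : cm.

(** By compactness some [m] makes [ev] yield a value for every oracle. It can be searched for: [ev]
    with bound [m] reads only the first [m] bits, so [2 ^ m] oracles represent all, and [F] counts
    those that fail. *)
Lemma modulus p G : (forall X n, run X p n (G X n)) ->
  exists2 u, cm (fun=> u) &
    forall n m X, u n <= m -> ev p X m n = (G X n).+1.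
Proof.
move=> Hp.
have evG X m n : ev p X m n != 0 -> ev p X m n = (G X n).+1.
  case E: ev => [|v] // _; have [m' E'] := ev_complete (Hp X n).
  by rewrite -(ev_mono (leq_maxl m m') E) -(ev_mono (leq_maxr m m') E').
pose F (X : cantor) n m := \sum_(0 <= c < 2 ^ m) (ev p (extend [::] c) m n == 0).
have F0 X n m : F X n m = 0 <-> forall Y, ev p Y m n != 0.
  split=> [F0 Y|H].
    have [c ltc Ec] := extend_prefix Y m; rewrite -(ev_local p n Ec).
    move/eqP: F0; rewrite sum_nat_seq_eq0 => /allP/(_ c).
    by rewrite mem_index_iota ltc /= eqb0; apply.
  by apply: big1 => c _; rewrite (negbTE (H _)).
have HF : cm (fun X n => F X (nfst n) (nsnd n)).
  by rewrite /F; auto 30 with cm.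
have [|u Hu Fu] := cm_search HF.
  move=> X n; have [|||m Hm] := @cantor_compact (fun Y m => ev p Y m n != 0).
  - by move=> Y Z m E; rewrite (ev_local p n E).
  - move=> Y m m' le; case E: (ev p Y m n) => [|v] // _.
    by rewrite (ev_mono le E).
  - by move=> Y; have [m E] := ev_complete (Hp Y n); exists m; rewrite E.
  by exists m; apply/F0.
(* [F] ignores its oracle, so the search may be run on the all-false one. *)
exists (u (fun=> false)).
  exact/computableP/computable_at0.
move=> n m X le.
have /F0/(_ X)/evG E := Fu (fun=> false) n.
exact: ev_mono E.
Qed.

(** * Rational martingales *)

Local Open Scope ring_scope.

(** A tail omits only finitely many values, which are bounded, so unboundedness of the whole
    sequence passes to every tail. *)
Lemma succeedsP (R : realType) (d : seq bool -> R) Z :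
  succeeds d Z <-> forall K, exists n, K < d (mkseq Z n).
Proof.
rewrite /succeeds /limn_esup limf_esupE ereal_inf_pinfty; split=> [H K|H x].
  have /H : [set ereal_sup ((fun n => (d (mkseq Z n))%:E) @` V) | V in \oo]
     (ereal_sup ((fun n => (d (mkseq Z n))%:E) @` setT)).
    by exists setT => //; exists 0%N.
  move=> E; have /ereal_sup_gt[_ [n _ <-]] :
    (K%:E < ereal_sup ((fun n => (d (mkseq Z n))%:E) @` setT))%E.
    by rewrite E ltry.
  by rewrite lte_fin; exists n.
move=> [V [N _ NV] <-] /=.
have [B HB] : exists B, forall i, (i < N)%N -> d (mkseq Z i) <= B.
  elim: N {NV} => [|N [B HB]]; first by exists 0.
  exists (Num.max B (d (mkseq Z N))) => i; rewrite ltnS leq_eqVlt => /orP[/eqP->|/HB].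
    by rewrite le_max lexx orbT.
  by rewrite le_max => ->.
apply/eqyP => K K0; have [n ltn] := H (Num.max K B).
have [ltnN|geN] := ltnP n N.
  by have := HB _ ltnN; rewrite leNgt (le_lt_trans _ ltn) // le_max lexx orbT.
apply: le_trans (ereal_sup_ubound _); last by exists n; first exact: NV.
by rewrite lee_fin ltW // (le_lt_trans _ ltn) // le_max lexx.
Qed.

Definition unbounded (D : seq bool -> rat) (Z : cantor) :=
  forall K : nat, exists n, K%:R <= D (mkseq Z n).

Lemma succeeds_ratr (R : realType) (D : seq bool -> rat) Z :
  succeeds (fun s => ratr (D s) : R) Z <-> unbounded D Z.
Proof.
rewrite succeedsP; split=> H K.
  have [n] := H K%:R; rewrite -(ratr_nat R K) ltr_rat => /ltW.
  by exists n.
have [n Hn] := H (Num.bound `|K|); exists n.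
apply: (@lt_le_trans _ _ (Num.bound `|K|)%:R).
  exact: le_lt_trans (ler_norm _) (archi_boundP (normr_ge0 K)).
by rewrite -(ratr_nat R) ler_rat.
Qed.

Definition qmartingale (D : seq bool -> rat) : Prop :=
  (forall s, 0 <= D s) /\
  (forall s, D (rcons s false) + D (rcons s true) = 2 * D s).

Lemma qmartingale_ratr (R : realType) D :
  qmartingale D -> martingale (fun s => ratr (D s) : R).
Proof.
move=> [D0 DE]; split=> s; first by rewrite ler0q.
by rewrite -rmorphD DE rmorphM /= ratr_nat.
Qed.

Lemma qmartingale_le D s b : qmartingale D -> D (rcons s b) <= 2 * D s.
Proof. by move=> [D0 <-]; case: b; rewrite ?lerDr ?lerDl. Qed.

Lemma encodes_const (R : realType) f D :
  (forall s k, code_approx f s k = D s) -> encodes f (fun s => ratr (D s) : R).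
Proof.
move=> E s; split=> [k m _|]; first by rewrite !E subrr normr0 exprn_ge0.
by under eq_fun do rewrite E; exact: cvg_cst.
Qed.

Lemma qmartingale_test (R : realType) (D : cantor -> seq bool -> rat) :
  (forall X, qmartingale (D X)) -> cq (fun X n => D X (str_of n)) ->
  exists Phi, uniform_martingale_test Phi (fun X s => ratr (D X s) : R).
Proof.
move=> mD [G HG E]; exists (fun X n => G X (nfst n)).
split=> [|X]; first by auto 30 with cm.
split; first exact: qmartingale_ratr.
by apply: encodes_const => s k; rewrite /code_approx nfst_npair -E str_codeK.
Qed.

Lemma qmartingale_computable (R : realType) (D : seq bool -> rat) :
  qmartingale D -> cq (fun X n => D (str_of n)) ->
  computable_martingale (fun s => ratr (D s) : R).
Proof.
move=> mD HD; have [//|Phi [HPhi H]] := @qmartingale_test R (fun=> D) _ HD.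
split; first exact: qmartingale_ratr.
by exists (Phi (fun=> false)); [exact: computable_at0 | case: (H (fun=> false))].
Qed.

Lemma encodes_dist (R : realType) f (d : seq bool -> R) s j : encodes f d ->
  `|ratr (code_approx f s j) - d s| <= 2^-1 ^+ j.
Proof.
move=> /(_ s)[fc cv]; apply/ler_addgt0Pr => e e0.
have /cvgrPdist_lt/(_ e e0)[N _ HN] := cv.
have {HN} H1 := HN (maxn N j) (leq_maxl _ _).
have H2 : `|ratr (code_approx f s (maxn N j)) - ratr (code_approx f s j)| <= 2^-1 ^+ j :> R.
  by rewrite -rmorphB -ratr_norm -(ratr_nat R 2) -fmorphV -rmorphXn ler_rat fc // leq_maxr.
rewrite distrC (le_trans (ler_distD (ratr (code_approx f s (maxn N j))) _ _)) //.
by rewrite addrC lerD // ltW.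
Qed.

(** * Exact rational values from codes *)

Definition sgnb (b : bool) : rat := if b then 1 else -1.

(* The exact rational martingale whose wagers are those read off the codes;
   the wager after [s] is off by at most [2^-|s|], so that the total error is
   at most 3. *)
Definition rationalize (f : baire) (s : seq bool) : rat :=
  code_approx f [::] 0 + 4 + \sum_(0 <= i < size s) sgnb (nth false s i) *
    ((code_approx f (rcons (take i s) true) i -
      code_approx f (rcons (take i s) false) i) / 2).

Lemma take_rconsl i (s : seq bool) b : (i <= size s)%N ->
  take i (rcons s b) = take i s.
Proof. by move=> le; rewrite -cats1 takel_cat. Qed.

Lemma rationalize_rcons f s b : rationalize f (rcons s b) =
  rationalize f s + sgnb b * ((code_approx f (rcons s true) (size s) -
      code_approx f (rcons s false) (size s)) / 2).
Proof.
rewrite /rationalize size_rcons big_nat_recr //= addrA; congr (_ + _ + _).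
  rewrite !big_nat; apply: eq_bigr => i /andP[_ lti].
  by rewrite nth_rcons lti take_rconsl // ltnW.
by rewrite nth_rcons ltnn eqxx take_rconsl // take_size.
Qed.

(** The initial value errs by at most 1 and the wager after [s] by half the sum of two errors
    [2^-|s|]; the bound is the closed form of [1 + 1 + 1/2 + ...] up to that stage. The offset 4
    thus leaves a margin of 1. *)
Lemma rationalize_dist (R : realType) f (d : seq bool -> R) s :
  martingale d -> encodes f d ->
  `|ratr (rationalize f s) - d s - 4| <= 3 - 2 * 2^-1 ^+ size s.
Proof.
move=> [_ md] ef; elim/last_ind: s => [|s b IHs].
  rewrite /rationalize big_geq // addr0 rmorphD /= ratr_nat.
  have := encodes_dist [::] 0 ef; rewrite expr0.
  by rewrite !ler_norml; lra.
rewrite rationalize_rcons size_rcons exprS.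
have := encodes_dist (rcons s true) (size s) ef.
have := encodes_dist (rcons s false) (size s) ef.
have := md s; move: IHs.
have -> x y z : ratr (x + sgnb b * ((y - z) / 2)) =
    ratr x + (if b then 1 else -1) * ((ratr y - ratr z) / 2) :> R.
  rewrite rmorphD !rmorphM rmorphB fmorphV /= ratr_nat.
  by case: b; rewrite ?rmorphN rmorph1.
by move: (_ ^+ size s) => e; rewrite !ler_norml; case: b => /=; lra.
Qed.

Lemma rationalize_ge (R : realType) f (d : seq bool -> R) s :
  martingale d -> encodes f d -> d s + 1 <= ratr (rationalize f s).
Proof.
move=> md ef; have := rationalize_dist s md ef.
have : 0 <= 2^-1 ^+ size s :> R by rewrite exprn_ge0.
by rewrite ler_norml; lra.
Qed.

Lemma rationalize_ge1 (R : realType) f (d : seq bool -> R) s :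
  martingale d -> encodes f d -> 1 <= rationalize f s.
Proof.
move=> md ef; have := rationalize_ge s md ef; case: md => /(_ s) ds _ H.
by rewrite -(ler_rat R) rmorph1; lra.
Qed.

Lemma rationalize_qmartingale (R : realType) f (d : seq bool -> R) :
  martingale d -> encodes f d -> qmartingale (rationalize f).
Proof.
move=> md ef; split=> s; first exact: le_trans (rationalize_ge1 s md ef).
by rewrite !rationalize_rcons /=; ring.
Qed.

Lemma rationalize_unbounded (R : realType) f (d : seq bool -> R) Z :
  martingale d -> encodes f d -> succeeds d Z -> unbounded (rationalize f) Z.
Proof.
move=> md ef /succeedsP sd; apply/(succeeds_ratr R)/succeedsP => K.
have [n Kn] := sd K; exists n; apply: lt_le_trans Kn _.
by have := rationalize_ge (mkseq Z n) md ef; lra.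
Qed.

Lemma cq_rationalize Phi S : cm Phi -> cs S ->
  cq (fun X n => rationalize (Phi X) (S X n)).
Proof. by move=> HPhi HS; rewrite /rationalize /code_approx /sgnb; auto 40 with cm. Qed.
#[local] Hint Resolve cq_rationalize : cm.

(** * Splitting a martingale into its even and odd bets *)

Definition cqs (D : cantor -> seq bool -> rat) := cq (fun X n => D X (str_of n)).

Lemma cq_cqs D S : cqs D -> cs S -> cq (fun X n => D X (S X n)).
Proof.
move=> HD HS; apply: (cq_ext _ (cq_comp HD (cm_str_code HS))) => X n.
by rewrite str_codeK.
Qed.
#[local] Hint Extern 5 (cq _) =>
  match goal with H : cqs _ |- _ => apply: (cq_cqs H) end : cm.

Definition part (s : bool) (Z : cantor) : cantor := fun n => Z (n.*2 + s)%N.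

Lemma part_join A B s : part s (join A B) = if s then B else A.
Proof.
apply/funext => n; rewrite /part /join oddD odd_double /=.
by case: s; rewrite /= ?addn0 ?addn1 /= ?uphalf_double ?doubleK.
Qed.

Lemma part_half (Z : cantor) i s : odd i = s -> part s Z i./2 = Z i.
Proof. by move=> <-; rewrite /part addnC odd_double_half. Qed.

Lemma eq_mkseq_prefix (f g : cantor) n : (forall i, (i < n)%N -> f i = g i) ->
  mkseq f n = mkseq g n.
Proof.
by move=> E; apply/eq_in_map => i; rewrite mem_iota => /andP[_]; apply: E.
Qed.

(** Positions of parity [s] carry the letters of [t], the others the oracle; the default bits past
    the end of [t] are never read by [bets]. *)
Definition weave (s : bool) (t : seq bool) (X : cantor) : cantor :=
  fun i => if odd i == s then nth false t i./2 else X i./2.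

Definition bets (D : seq bool -> rat) (s : bool) (X : cantor) (t : seq bool) : rat :=
  \prod_(0 <= i < size t) (D (mkseq (weave s t X) (i.*2 + s).+1) /
                           D (mkseq (weave s t X) (i.*2 + s))).

Lemma weave_rcons (s : bool) t b X n : (n <= (size t).*2 + s)%N ->
  mkseq (weave s (rcons t b) X) n = mkseq (weave s t X) n.
Proof.
move=> len; apply: eq_mkseq_prefix => i ltin; rewrite /weave; case: eqP => // Es.
by rewrite nth_rcons ifT //; move: (ltin) Es; case: s len => /=; lia.
Qed.

Lemma bets_rcons D s X t b : bets D s X (rcons t b) = bets D s X t *
  (D (rcons (mkseq (weave s t X) ((size t).*2 + s)) b) /
   D (mkseq (weave s t X) ((size t).*2 + s))).
Proof.
rewrite /bets size_rcons big_nat_recr //=; congr (_ * (D _ / D _)).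
- rewrite !big_nat; apply: eq_bigr => i /andP[_ lti].
  by rewrite !weave_rcons //; case: s; lia.
- rewrite mkseqS weave_rcons //; congr rcons.
  rewrite /weave oddD odd_double (_ : ((size t).*2 + s)./2 = size t)%N; last first.
    by case: s; lia.
  by case: s; rewrite /= nth_rcons ltnn eqxx.
- by rewrite weave_rcons.
Qed.

Lemma bets_qmartingale D s X : qmartingale D -> (forall t, 1 <= D t) ->
  qmartingale (bets D s X).
Proof.
move=> [D0 mD] D1; split=> t; first by apply: prodr_ge0 => i _; rewrite divr_ge0.
rewrite !bets_rcons -mulrDr -mulrDl mD mulrC mulfK //.
by rewrite gt_eqF // (lt_le_trans _ (D1 _)).
Qed.

Lemma bets_part D s Z n : bets D s (part (~~ s) Z) (mkseq (part s Z) n) =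
  \prod_(0 <= i < n) (D (mkseq Z (i.*2 + s).+1) / D (mkseq Z (i.*2 + s))).
Proof.
rewrite /bets size_mkseq !big_nat; apply: eq_bigr => i /andP[_ lti].
have E m : (m <= n.*2)%N ->
    mkseq (weave s (mkseq (part s Z) n) (part (~~ s) Z)) m = mkseq Z m.
  move=> lem; apply: eq_mkseq_prefix => j ltj; rewrite /weave.
  case: eqP => [Es|/eqP Es]; first by rewrite nth_mkseq ?part_half //; lia.
  by rewrite part_half //; move: Es; case: odd; case: s.
by rewrite !E //; case: s {E}; lia.
Qed.

(** The product of all successive ratios telescopes. An even length gives both bets the same number
    [n] of factors. *)
Lemma bets_factor D Z n : (forall t, 1 <= D t) ->
  D (mkseq Z n.*2) = D [::] *
    bets D false (part true Z) (mkseq (part false Z) n) *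
    bets D true (part false Z) (mkseq (part true Z) n).
Proof.
move=> D1; have Dn0 t : D t != 0 by rewrite gt_eqF // (lt_le_trans _ (D1 _)).
have -> := bets_part D false Z n; have -> := bets_part D true Z n.
elim: n => [|n IHn]; first by rewrite !big_geq // !mulr1.
rewrite !big_nat_recr //= doubleS addn0 addn1.
move: IHn; set a := \prod_(_ <= _ < _) _; set b := \prod_(_ <= _ < _) _ => IHn.
rewrite [RHS](_ : _ = (D [::] * a * b) / D (mkseq Z n.*2) * D (mkseq Z n.*2.+2)).
  by rewrite -IHn divff // mul1r.
by field; rewrite !Dn0.
Qed.

Lemma qmartingale_unbounded_even D Z K : qmartingale D -> unbounded D Z ->
  exists n, K%:R <= D (mkseq Z n.*2).
Proof.
(* One bit at most doubles a martingale, so a value of [2 * K] leaves at least [K] after rounding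
   the length down to an even one. *)
move=> mD /(_ (2 * K)%N)[n Kn]; exists n./2; rewrite natrM in Kn.
move: Kn; rewrite -{1}(odd_double_half n); case: (odd n) => /= Kn; last first.
  by apply: le_trans Kn; rewrite ler_peMl ?ler0n // ler1n.
have := qmartingale_le (mkseq Z n./2.*2) (Z n./2.*2) mD.
by rewrite -mkseqS => le; have := le_trans Kn le; rewrite ler_pM2l.
Qed.

Lemma bets_unbounded D Z : qmartingale D -> (forall t, 1 <= D t) ->
  unbounded D Z -> exists s, unbounded (bets D s (part (~~ s) Z)) (part s Z).
Proof.
move=> mD D1 uD; apply: contrapT => /forallNP H.
have bounded s : exists K : nat, forall n,
    bets D s (part (~~ s) Z) (mkseq (part s Z) n) <= K%:R.
  have /existsNP[K HK] := H s; exists K => n; apply: contrapT => /negP Kn.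
  by apply: HK; exists n; rewrite ltW // ltNge.
have [[K0 H0] [K1 H1]] := (bounded false, bounded true).
have D00 : 0 <= D [::] by rewrite (le_trans _ (D1 _)).
pose C := D [::] * K0%:R * K1%:R.
have [n] := qmartingale_unbounded_even (Num.bound C) mD uD.
apply/negP; rewrite -ltNge; apply: (@le_lt_trans _ _ C).
  rewrite bets_factor // /C; apply: ler_pM => //.
  - by rewrite mulr_ge0 //; case: (bets_qmartingale false (part true Z) mD D1).
  - by case: (bets_qmartingale true (part false Z) mD D1).
  - by rewrite ler_wpM2l.
by apply: archi_boundP; rewrite !mulr_ge0.
Qed.

Lemma cqs_bets D s : cqs (fun=> D) -> cqs (bets D s).
Proof.
move=> HD; rewrite /cqs /bets /weave.
have HD' S : cs S -> cq (fun X n => D (S X n)) by exact: (cq_cqs HD).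
by auto 50 with cm.
Qed.

Lemma computably_random_part (R : realType) Z :
  (forall s, computably_random_uniformly_rel R (part s Z) (part (~~ s) Z)) ->
  computably_random R Z.
Proof.
move=> H [d [md [f /computableP cf ef]] sd].
have mD := rationalize_qmartingale md ef.
have D1 s := rationalize_ge1 s md ef.
have [s us] := bets_unbounded mD D1 (rationalize_unbounded md ef sd).
have cD : cqs (fun=> rationalize f).
  by apply: (@cq_rationalize (fun=> f)); auto 30 with cm.
have [|Phi HPhi] := @qmartingale_test R (bets (rationalize f) s) _ (cqs_bets s cD).
  by move=> X; apply: bets_qmartingale.
by apply: (H s); exists Phi, (fun X t => ratr (bets (rationalize f) s X t));
  last exact/succeeds_ratr.
Qed.

(** * A martingale that saves its gains *)

Definition runmax (u : nat -> rat) (n : nat) : rat :=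
  nat_rect (fun=> rat) (u 0) (fun j r => Num.max r (u j.+1)) n.

Lemma runmaxS u n : runmax u n.+1 = Num.max (runmax u n) (u n.+1).
Proof. by []. Qed.

Lemma eq_runmax u v n : (forall i, (i <= n)%N -> u i = v i) ->
  runmax u n = runmax v n.
Proof.
elim: n => [|n IHn] E; first exact: E.
by rewrite !runmaxS IHn ?E // => i le; apply: E; apply: leqW.
Qed.

Lemma runmax_ge u i n : (i <= n)%N -> u i <= runmax u n.
Proof.
elim: n => [|n IHn]; first by rewrite leqn0 => /eqP->.
rewrite runmaxS le_max leq_eqVlt => /orP[/eqP->|/IHn->//].
by rewrite lexx orbT.
Qed.

Lemma runmax_le u i n : (i <= n)%N -> runmax u i <= runmax u n.
Proof.
elim: n => [|n IHn]; first by rewrite leqn0 => /eqP->.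
by rewrite leq_eqVlt => /orP[/eqP->//|/IHn le]; rewrite runmaxS le_max le.
Qed.

(* Scaling the wager of [u] at stage [i] by [1 / max_(j <= i) u j] makes the
   total equal to [u n / runmax u n], which lies in [0, 1], plus the
   nondecreasing [gain u n], which is unbounded if [u] is. *)
Definition saving (u : nat -> rat) (n : nat) : rat :=
  1 + \sum_(0 <= i < n) (u i.+1 - u i) / runmax u i.

Definition gain (u : nat -> rat) (n : nat) : rat :=
  \sum_(0 <= i < n) u i.+1 * ((runmax u i)^-1 - (runmax u i.+1)^-1).

Lemma savingS u n :
  saving u n.+1 = saving u n + (u n.+1 - u n) / runmax u n.
Proof. by rewrite /saving big_nat_recr //= addrA. Qed.

Lemma gainS u n :
  gain u n.+1 = gain u n + u n.+1 * ((runmax u n)^-1 - (runmax u n.+1)^-1).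
Proof. by rewrite /gain big_nat_recr. Qed.

Lemma eq_saving u v n : (forall i, (i <= n)%N -> u i = v i) ->
  saving u n = saving v n.
Proof.
move=> E; rewrite /saving !big_nat; congr (_ + _); apply: eq_bigr => i /andP[_ lti].
rewrite (@eq_runmax u v) => [|j lej]; last by apply: E; lia.
by rewrite (E _ lti) (E _ (ltnW lti)).
Qed.

Section Saving.
Variable u : nat -> rat.
Hypothesis u1 : forall i, 1 <= u i.

Let m0 n : 0 < runmax u n.
Proof. exact: lt_le_trans (le_trans (u1 n) (runmax_ge u (leqnn n))). Qed.

Let ratio_ge0 n : 0 <= u n / runmax u n.
Proof. by rewrite divr_ge0 ?ltW // (lt_le_trans _ (u1 n)). Qed.

(** Summation by parts. *)
Lemma saving_gain n : saving u n = u n / runmax u n + gain u n.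
Proof.
elim: n => [|n IHn].
  rewrite /saving /gain !big_geq // !addr0 divff // gt_eqF //.
  exact: (m0 0).
by rewrite savingS gainS IHn; ring.
Qed.

(** Both sides vanish unless [u n.+1] is a new maximum; then the increment is the growth of the
    maximum divided by its old value, which is at most [M]. *)
Lemma gain_step n M : runmax u n.+1 <= M ->
  (runmax u n.+1 - runmax u n) / M <=
  u n.+1 * ((runmax u n)^-1 - (runmax u n.+1)^-1).
Proof.
move=> leM; have M0 := lt_le_trans (m0 n.+1) leM.
move: (m0 n) (m0 n.+1) leM; rewrite runmaxS maxEle.
case: ifP => [le|_] a0 b0 leM; last by rewrite !subrr mul0r mulr0.
have -> : u n.+1 * ((runmax u n)^-1 - (u n.+1)^-1) =
    (u n.+1 - runmax u n) / runmax u n.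
  by field; rewrite !gt_eqF.
by rewrite ler_wpM2l ?subr_ge0 // lef_pV2 ?posrE // (le_trans le).
Qed.

(** Telescoping with a common denominator. With [M] the final maximum, the gain grows by at least
    1/2 once the maximum has doubled. *)
Lemma gain_ge i k M : runmax u (i + k) <= M ->
  gain u i + (runmax u (i + k) - runmax u i) / M <= gain u (i + k).
Proof.
elim: k => [|k IHk]; first by rewrite addn0 subrr mul0r addr0.
rewrite addnS => leM; rewrite gainS.
have := IHk (le_trans (runmax_le u (leqnSn _)) leM).
by have := gain_step leM; lra.
Qed.

Lemma gain_homo i n : (i <= n)%N -> gain u i <= gain u n.
Proof.
move=> /subnKC <-; apply: le_trans (gain_ge (lexx _)).
by rewrite lerDl divr_ge0 ?subr_ge0 ?runmax_le ?leq_addr // ltW.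
Qed.

Lemma saving_ge0 n : 0 <= saving u n.
Proof.
rewrite saving_gain addr_ge0 //.
by apply: le_trans (gain_homo (leq0n n)); rewrite /gain big_geq.
Qed.

Lemma saving_ge i n : (i <= n)%N -> saving u i - 1 <= saving u n.
Proof.
move=> le; rewrite !saving_gain; have := gain_homo le.
have : u i / runmax u i <= 1 by rewrite ler_pdivrMr // mul1r runmax_ge.
have := ratio_ge0 n; lra.
Qed.

Lemma saving_unbounded : (forall K : nat, exists n, K%:R <= u n) ->
  forall K : nat, exists n, K%:R <= saving u n.
Proof.
move=> uu; suff H K : exists n, K%:R / 2 <= gain u n.
  move=> K; have [n] := H (2 * K)%N; rewrite natrM => Kn; exists n.
  by rewrite saving_gain; have := ratio_ge0 n; lra.
(* Each induction step waits until [u] exceeds twice its current maximum, which adds at least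
   1/2. *)
elim: K => [|K [i Hi]]; first by exists 0%N; rewrite /gain big_geq // mul0r.
have [n Hn] := uu (Num.bound (2 * runmax u i)).
have lt2 : 2 * runmax u i < u n.
  by apply: lt_le_trans Hn; apply: archi_boundP; rewrite mulr_ge0 // ltW.
have lein : (i <= n)%N.
  rewrite leqNgt; apply/negP => /ltnW/(runmax_ge u); have := m0 i; lra.
exists n; rewrite -(subnKC lein); apply: le_trans (gain_ge (lexx _)).
rewrite (subnKC lein) -natr1 mulrDl lerD // ler_pdivlMr //.
by have := runmax_ge u (leqnn n); lra.
Qed.

End Saving.

Definition save (D : seq bool -> rat) (s : seq bool) : rat :=
  saving (fun i => D (take i s)) (size s).

Lemma save_rcons D s b : save D (rcons s b) =
  save D s + (D (rcons s b) - D s) / runmax (fun i => D (take i s)) (size s).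
Proof.
have E i : (i <= size s)%N -> D (take i (rcons s b)) = D (take i s).
  by move=> le; rewrite take_rconsl.
rewrite /save size_rcons savingS (eq_saving E) (eq_runmax E) (E (size s)) //.
by rewrite take_size -[in LHS](size_rcons s b) take_size.
Qed.

(** The factor applied to the wager after [s] depends on [s] alone, so the bet stays fair. *)
Lemma save_qmartingale D : qmartingale D -> (forall s, 1 <= D s) ->
  qmartingale (save D).
Proof.
move=> [_ mD] D1; split=> s; first by apply: saving_ge0.
rewrite !save_rcons; set r := runmax _ _.
have -> a b c : a + (b - c) / r + (a + (D (rcons s true) - c) / r) =
   2 * a + (b + D (rcons s true) - 2 * c) / r by ring.
by rewrite mD subrr mul0r addr0.
Qed.

Lemma save_mkseq D Z n : save D (mkseq Z n) = saving (fun i => D (mkseq Z i)) n.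
Proof.
rewrite /save size_mkseq; apply: eq_saving => i le; congr D.
by rewrite /mkseq -map_take take_iota (minn_idPl le).
Qed.

Lemma cqs_save D : cqs D -> cqs (fun X => save (D X)).
Proof.
move=> HD; rewrite /cqs /save /saving.
have HM S K : cs S -> cm K ->
    cq (fun X n => runmax (fun i => D X (take i (S X n))) (K X n)).
  move=> HS HK; apply: (@cq_rec Num.max (fun X n => D X (take 0 (S X n)))
    (fun X n j => D X (take j.+1 (S X n))) K); by [exact: cq_max | auto 30 with cm].
by auto 50 with cm.
Qed.

(** * Averaging over the oracle *)

Lemma extend_rcons t b c : extend (rcons t b) c = extend t (c.*2 + b)%N.
Proof.
apply/funext => i; rewrite /extend size_rcons nth_rcons ltnS leq_eqVlt.
case: ltngtP => [lti|lti|->] /=; last by rewrite subnn /= oddD odd_double; case: b.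
- by [].
- rewrite -(subnSK lti) iterSr; congr (odd (iter _ _ _)).
  by case: b; lia.
Qed.

Lemma extend_prefix_eq t c c' i : (i < size t)%N -> extend t c i = extend t c' i.
Proof. by rewrite /extend => ->. Qed.

(** This is the expectation of [F] over the oracles extending [t], provided that [F] depends only on
    the first [size t + k] bits. *)
Definition average (k : nat) (t : seq bool) (F : cantor -> rat) : rat :=
  (\sum_(0 <= c < (2 ^ k)%N) F (extend t c)) / (2 ^ k)%N%:R.

Lemma sum_double (f : nat -> rat) n :
  \sum_(0 <= c < n.*2) f c = \sum_(0 <= c < n) (f c.*2 + f c.*2.+1).
Proof.
elim: n => [|n IHn]; first by rewrite !big_geq.
by rewrite doubleS !big_nat_recr //= IHn addrA.
Qed.

(** The lowest digit of [c] is the letter that follows [t], so even and odd [c] separate the two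
    children of [t]. *)
Lemma averageS k t F : average k.+1 t F =
  (average k (rcons t false) F + average k (rcons t true) F) / 2.
Proof.
rewrite /average expnS mul2n sum_double -mul2n natrM big_split /=.
under [in RHS]eq_bigr do rewrite extend_rcons addn0.
under [X in _ = (_ + X / _) / _]eq_bigr do rewrite extend_rcons addn1.
by rewrite invfM; ring.
Qed.

(** The induction moves bits from the continuation into [t], keeping [size t + k] fixed, until [F]
    is constant on the extensions of [t]. *)
Lemma average_stable k k' t F : (k <= k')%N ->
  (forall X Y, (forall i, (i < size t + k)%N -> X i = Y i) -> F X = F Y) ->
  average k' t F = average k t F.
Proof.
elim: k k' t => [|k IHk] k' t.
  move=> _ FE; elim: k' t FE => [|k' IHk'] t FE //.
  rewrite averageS !IHk'; last first.
  - by move=> X Y E; apply: FE => i lti; apply: E; rewrite size_rcons; lia.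
  - by move=> X Y E; apply: FE => i lti; apply: E; rewrite size_rcons; lia.
  rewrite /average expn0 !big_nat1 !divr1 !extend_rcons.
  rewrite !(FE (extend t _) (extend t 0)); first by field.
  - by move=> i lti; apply: extend_prefix_eq; lia.
  - by move=> i lti; apply: extend_prefix_eq; lia.
case: k' => // k' lek FE; rewrite !averageS !IHk //.
- by move=> X Y E; apply: FE => i lti; apply: E; rewrite size_rcons; lia.
- by move=> X Y E; apply: FE => i lti; apply: E; rewrite size_rcons; lia.
Qed.

Lemma average_ge k t F K :
  (forall X, (forall i, (i < size t)%N -> X i = nth false t i) -> K <= F X) ->
  K <= average k t F.
Proof.
move=> FK; rewrite /average ler_pdivlMr ?ltr0n ?expn_gt0 //.
rewrite mulr_natr -{1}[(2 ^ k)%N]subn0 -sumr_const_nat; apply: ler_sum => c _.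
by apply: FK => i lti; rewrite /extend lti.
Qed.

Lemma averageD k t F G :
  average k t (fun X => F X + G X) = average k t F + average k t G.
Proof. by rewrite /average big_split mulrDl. Qed.

Lemma averageM k t a F : average k t (fun X => a * F X) = a * average k t F.
Proof. by rewrite /average -mulr_sumr mulrA. Qed.

(** The term [~~ s] rounds the half up for the even positions, which outnumber the odd ones by one
    when the length is odd. *)
Definition subword (s : bool) (r : seq bool) : seq bool :=
  mkseq (fun i => nth false r (i.*2 + s)%N) (size r + ~~ s)%N./2.

Lemma subword_rcons s r b : subword s (rcons r b) =
  if odd (size r) == s then rcons (subword s r) b else subword s r.
Proof.
have E n : (n <= (size r + ~~ s)%N./2)%N ->
  mkseq (fun i => nth false (rcons r b) (i.*2 + s)%N) n =
  mkseq (fun i => nth false r (i.*2 + s)%N) n.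
  move=> len; apply: eq_mkseq_prefix => i lti; rewrite nth_rcons ifT //.
  by case: s len => /=; lia.
rewrite /subword size_rcons; case: eqP => Es.
  rewrite (_ : ((size r).+1 + ~~ s)%N./2 = (size r + ~~ s)%N./2.+1); last first.
    by case: s {E} Es => /=; lia.
  rewrite mkseqS E //; congr rcons.
  rewrite (_ : ((size r + ~~ s)%N./2.*2 + s)%N = size r); last first.
    by case: s {E} Es => /=; lia.
  by rewrite nth_rcons ltnn eqxx.
rewrite (_ : ((size r).+1 + ~~ s)%N./2 = (size r + ~~ s)%N./2) ?E //.
by case: s {E} Es => /=; lia.
Qed.

Lemma subword_mkseq s Z n : subword s (mkseq Z n.*2) = mkseq (part s Z) n.
Proof.
rewrite /subword size_mkseq (_ : (n.*2 + ~~ s)%N./2 = n); last by case: s; lia.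
by apply: eq_mkseq_prefix => i lti; rewrite nth_mkseq //; case: s; lia.
Qed.

Lemma cs_subword s S : cs S -> cs (fun X n => subword s (S X n)).
Proof. by move=> HS; rewrite /subword; auto 30 with cm. Qed.
#[local] Hint Resolve cs_subword : cm.

Section Averaging.
Variables (D : cantor -> seq bool -> rat) (s : bool).
Hypothesis mD : forall X, qmartingale (D X).
Hypothesis cD : cqs D.

(** [M r] is the expectation of [D X] at the letters of [r] of parity [s], over the [X] extending
    its other letters. A new letter of parity [s] is a bet of [D], fair by linearity; any other
    letter halves the set of oracles. *)
Lemma average_martingale : exists M, [/\ qmartingale M, cqs (fun=> M) &
  forall K r, (forall X, (forall i, (i < size (subword (~~ s) r))%N ->
      X i = nth false (subword (~~ s) r) i) -> K <= D X (subword s r)) ->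
    K <= M r].
Proof.
have [G [p Hp] DG] := cD; have [u cu Hu] := modulus Hp.
have DE X t m : (u (str_code t) <= m)%N ->
    D X t = rat_of_code (ev p X m (str_code t)).-1.
  by move=> le; rewrite (Hu _ _ X le) -DG str_codeK.
have Dloc X Y t k : (u (str_code t) <= k)%N ->
    (forall i, (i < k)%N -> X i = Y i) -> D X t = D Y t.
  by move=> le E; rewrite !(DE _ _ k) // (ev_local p _ E).
pose lev r := u (str_code (subword s r)).
pose M r := average (lev r) (subword (~~ s) r) (D^~ (subword s r)).
have ME r k : (lev r <= k)%N ->
    M r = average k (subword (~~ s) r) (D^~ (subword s r)).
  move=> le; apply/esym/average_stable => // X Y E; apply: (Dloc _ _ _ (lev r)) => //.
  by move=> i lti; apply: E; apply: ltn_addl.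
exists M; split; first split=> r.
- by apply: average_ge => X _; case: (mD X).
- pose k := maxn (lev r) (maxn (lev (rcons r false)) (lev (rcons r true))).
  have odd_not : (odd (size r) == ~~ s) = ~~ (odd (size r) == s).
    by case: odd; case: s.
  case Es: (odd (size r) == s).
    rewrite !(ME _ k); try by rewrite /k; lia.
    rewrite !subword_rcons odd_not Es /= -averageD -averageM.
    by congr average; apply/funext => X; case: (mD X).
  (* A new oracle letter uses up one bit of averaging, whence level [k.+1] at [r] against [k] at its
     children. *)
  rewrite (ME r k.+1) 1?(ME (rcons r false) k) 1?(ME (rcons r true) k);
    try by rewrite /k; lia.
  by rewrite averageS !subword_rcons odd_not Es /=; field.
(* The modulus turns the values of [D] into bounded evaluations on finitely many explicit oracles;
   [.-1] undoes the shift of [ev]. *)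
- apply: (@cq_ext _ (fun X n => (\sum_(0 <= c < (2 ^ lev (str_of n))%N)
    rat_of_code (ev p (extend (subword (~~ s) (str_of n)) c) (lev (str_of n))
      (str_code (subword s (str_of n)))).-1) / (2 ^ lev (str_of n))%N%:R)).
    move=> X n; rewrite /M /average; congr (_ / _); apply: eq_bigr => c _.
    by rewrite -DE.
  have Hlev S : cs S -> cm (fun X n => lev (S X n)).
    by move=> HS; apply: (cm_comp cu); auto 30 with cm.
  by auto 50 with cm.
- by move=> K r H; apply: average_ge.
Qed.

End Averaging.

Lemma computably_random_uniformly_rel_part (R : realType) Z s :
  computably_random R Z ->
  computably_random_uniformly_rel R (part s Z) (part (~~ s) Z).
Proof.
move=> H [Phi [d [cPhi Hd] sd]].
pose D X := rationalize (Phi X).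
have mD X : qmartingale (D X) by case: (Hd X); exact: rationalize_qmartingale.
have D1 X t : 1 <= D X t by case: (Hd X); exact: rationalize_ge1.
have cD : cqs D by apply: cq_rationalize => //; auto 30 with cm.
have mS X : qmartingale (save (D X)) by apply: save_qmartingale.
have [M [mM cM geM]] := average_martingale s mS (cqs_save cD).
apply: H; exists (fun r => ratr (M r)); first exact: qmartingale_computable.
apply/succeeds_ratr => K.
set A := part s Z; set B := part (~~ s) Z.
have uD : unbounded (D B) A.
  by case: (Hd B) => md ed; apply: rationalize_unbounded md ed sd.
(* [K.+1] leaves room for the loss of 1 that saving permits. *)
have [n0] := saving_unbounded (fun i => D1 B (mkseq A i)) uD K.+1.
rewrite -save_mkseq => Kn0.
(* The computation of this one value queries finitely many bits of [B]. *)
have [m loc] : exists m, forall X, (forall i, (i < m)%N -> X i = B i) ->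
    save (D X) (mkseq A n0) = save (D B) (mkseq A n0).
  have [G [p Hp] DG] := cqs_save cD.
  have [m Em] := ev_complete (Hp B (str_code (mkseq A n0))).
  exists m => X E; rewrite -[mkseq A n0]str_codeK !DG; congr rat_of_code.
  have [m' Em'] := ev_complete (Hp X (str_code (mkseq A n0))).
  have := ev_mono (leq_maxl m m') (etrans (ev_local p _ E) Em).
  by rewrite (ev_mono (leq_maxr m m') Em') => -[].
(* At this length the two subwords contain at least [n0] letters of [A] and [m] letters of [B]. *)
exists (maxn n0 m).*2; apply: geM => X; rewrite !subword_mkseq size_mkseq => XB.
rewrite save_mkseq.
have := saving_ge (fun i => D1 X (mkseq A i)) (leq_maxl n0 m).
rewrite -save_mkseq loc => [|i lti].
  by move: Kn0; rewrite -natr1; lra.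
by rewrite XB ?nth_mkseq //; lia.
Qed.

Theorem theorem5p3 (R : realType) (A B : cantor) :
  computably_random R (join A B) <->
  computably_random_uniformly_rel R A B /\
  computably_random_uniformly_rel R B A.
Proof.
split=> [H|[HA HB]].
  have := computably_random_uniformly_rel_part (s := true) H.
  have := computably_random_uniformly_rel_part (s := false) H.
  by rewrite !part_join.
by apply: computably_random_part => s; rewrite !part_join; case: s.
Qed.
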